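(* Let $\sigma = (\lambda_1,\lambda_2,\lambda_3,\lambda_4,\lambda_5)$ be a list of real numbers such that (i) $e_1(\sigma) \ge 0$; (ii) $\lambda_1 \ge \lambda_2 \ge \lambda_3 \ge \lambda_4 \ge \lambda_5 > -\lambda_1$; (iii) $\lambda_3 > e_1(\sigma)$; (iv) $r(\sigma) \ge 0$. Then $\sigma_i^{-s}$ is realizable by a $5\times5$ symmetric nonnegative matrix for any positive real number $s$ and any $i\in\{2,3,4,5\}$.
   Context: For a list $\sigma=(\lambda_1,\dots,\lambda_5)$, $e_n(\sigma)=\sum_{1\le j_1<\dots<j_n\le 5}\prod_{i=1}^n \lambda_{j_i}$ are the elementary symmetric functions (so $e_1(\sigma)=\sum_i\lambda_i$), and $r(\sigma)=e_3(\sigma)+e_1(\sigma)(\lambda_2^2+\lambda_5^2)$. For $s>0$ and $i\in\{2,\dots,5\}$, $\sigma_i^{-s}$ denotes the list $\sigma$ with $\lambda_1$ replaced by $\lambda_1+s$ and $\lambda_i$ replaced by $\lambda_i-s$. A matrix is nonnegative if all its entries are nonnegative real numbers. A list is realizable by a matrix if it is the spectrum of that matrix, eigenvalues being counted with multiplicity and the order of the list being irrelevant. *)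

(* Defs.v *)
From HB Require Import structures.
From mathcomp Require Import all_boot all_order all_algebra.
From mathcomp Require Import reals.

Set Implicit Arguments.
Unset Strict Implicit.
Unset Printing Implicit Defensive.

Import Order.TTheory GRing.Theory Num.Theory.
Local Open Scope ring_scope.

(* Lists are tuples indexed from 0: the informal lambda_k is sigma`_(k - 1). *)

Definition esymf (R : realType) (m n : nat) (sigma : m.-tuple R) : R :=
  \sum_(J : {set 'I_m} | #|J| == n) \prod_(j in J) tnth sigma j.

Definition rfun (R : realType) (sigma : 5.-tuple R) : R :=
  esymf 3 sigma + esymf 1 sigma * (sigma`_1 ^+ 2 + sigma`_4 ^+ 2).

(* The list sigma_i^{-s}; meaningful only when i != ord0. *)
Definition shift_list (R : realType) (sigma : 5.-tuple R) (i : 'I_5) (s : R) :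
    5.-tuple R :=
  [tuple if j == ord0 then tnth sigma j + s
         else if j == i then tnth sigma j - s
         else tnth sigma j | j < 5].

Definition nonneg_mx (R : realType) (m n : nat) (A : 'M[R]_(m, n)) : Prop :=
  forall i j, 0 <= A i j.

Definition symmetric_mx (R : realType) (n : nat) (A : 'M[R]_n) : Prop :=
  A^T = A.

(* The eigenvalues of A, with algebraic multiplicity, are the entries of sigma,
   in any order. *)
Definition has_spectrum (R : realType) (n : nat) (A : 'M[R]_n)
    (sigma : n.-tuple R) : Prop :=
  char_poly A = \prod_(x <- sigma) ('X - x%:P).

Definition sym_nonneg_realizable (R : realType) (n : nat)
    (sigma : n.-tuple R) : Prop :=
  exists A : 'M[R]_n,
    [/\ symmetric_mx A, nonneg_mx A & has_spectrum A sigma].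

(* Main.v *)
Require Import Defs.
From HB Require Import structures.
From mathcomp Require Import all_boot all_order all_algebra.
From mathcomp Require Import reals.
From mathcomp Require Import ring lra.

Set Implicit Arguments.
Unset Strict Implicit.
Unset Printing Implicit Defensive.

Import Order.TTheory GRing.Theory Num.Theory.
Local Open Scope ring_scope.

(* A symmetric matrix on vertices w, p, c, p', c' that commutes with the
   involution p <-> p', c <-> c' splits, up to similarity, into a 3x3 block
   (symmetric vectors) and a 2x2 block (antisymmetric vectors).  With weights
   on the 5-cycle w p c c' p', the chord p p' and a loop at w only,
   prescribing the eigenvalues l1, l3, l4 on the symmetric and l2, l5 on the
   antisymmetric part determines all entries, and the chord has weight
   r(sigma) / S with S > 0; the other hypotheses make the remaining entries
   nonnegative, so what is left is r(sigma) >= 0.  Passing from sigma to a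
   shifted list increases r, and the other constraints for the cycle survive as
   long as lambda_2 - s >= 0 when i = 2, or lambda_3 - s >= e_1 when i = 3.
   Beyond these thresholds two other matrices with the same symmetry realize
   the list. *)

(** * Explicit polynomials for e_1 and r *)

Lemma esymf_coef (R : realType) (m n : nat) (sigma : m.-tuple R) :
  esymf n sigma = (\prod_(i < m) (tnth sigma i *: 'X + 1))`_n.
Proof.
rewrite bigA_distr coef_sum /esymf big_mkcond; apply: eq_bigr => J _.
have -> : \prod_(i < m) (if i \in J then tnth sigma i *: 'X else 1) =
    (\prod_(i in J) tnth sigma i) *: 'X^#|J| :> {poly R}.
  by rewrite -big_mkcond scaler_prod prodr_const.
by rewrite coefZ coefXn eq_sym; case: eqP; rewrite ?mulr1 ?mulr0.
Qed.

(** Peeling off one factor at a time evaluates e_n on a concrete list without enumerating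
    subsets. *)
Lemma coef_linear_mul (R : nzRingType) (a : R) (p : {poly R}) (n : nat) :
  ((a *: 'X + 1) * p)`_n = (if n is k.+1 then a * p`_k else 0) + p`_n.
Proof.
by rewrite mulrDl mul1r -scalerAl coefD coefZ coefXM; case: n; rewrite ?mulr0.
Qed.

Lemma esymf1_5 (R : realType) (sigma : 5.-tuple R) :
  esymf 1 sigma = sigma`_0 + sigma`_1 + sigma`_2 + sigma`_3 + sigma`_4.
Proof.
rewrite esymf_coef !big_ord_recl big_ord0 !coef_linear_mul !coef1 /=.
rewrite !(tnth_nth 0) /=; ring.
Qed.

Definition r5 (R : nzRingType) (l1 l2 l3 l4 l5 : R) : R :=
  l1 * l2 * (l3 + l4 + l5) + (l1 + l2) * (l3 * l4 + l3 * l5 + l4 * l5)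
  + l3 * l4 * l5 + (l1 + l2 + l3 + l4 + l5) * (l2 ^+ 2 + l5 ^+ 2).

Lemma rfun_r5 (R : realType) (sigma : 5.-tuple R) :
  rfun sigma = r5 sigma`_0 sigma`_1 sigma`_2 sigma`_3 sigma`_4.
Proof.
rewrite /rfun /r5 esymf1_5; congr (_ + _).
rewrite esymf_coef !big_ord_recl big_ord0 !coef_linear_mul !coef1 /=.
rewrite !(tnth_nth 0) /=; ring.
Qed.

(** * Block decomposition under the swap symmetry *)

Lemma char_poly_sim (R : comNzRingType) (n : nat) (A B T : 'M[R]_n) :
  A *m T = T *m B -> \det T = 1 -> char_poly A = char_poly B.
Proof.
move=> AT detT; have detTX : \det (map_mx (@polyC R) T) = 1.
  by rewrite det_map_mx detT.
rewrite /char_poly -[LHS]mulr1 -[RHS]mul1r -{1}detTX -detTX -!det_mulmx.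
congr (\det _); rewrite /char_poly_mx mulmxBl mulmxBr -!map_mxM AT.
by rewrite scalar_mxC.
Qed.

Lemma char_poly_ublock (R : comNzRingType) (m n : nat) (A : 'M[R]_(m + n)) :
  dlsubmx A = 0 -> char_poly A = char_poly (ulsubmx A) * char_poly (drsubmx A).
Proof.
move=> A0; rewrite -[A in LHS]submxK A0 /char_poly /char_poly_mx.
rewrite (map_block_mx (@polyC R)) map_mx0 scalar_mx_block opp_block_mx.
by rewrite add_block_mx oppr0 addr0 det_ublock.
Qed.

Definition rows_mx (K : nzRingType) (m n : nat) (s : seq (seq K)) :
  'M[K]_(m, n) := \matrix_(i, j) nth 0 (nth [::] s i) j.

(** Rows follow the order w, p, c, p', c': [h] and [k] are loops at p and c, [x] and [z] join p p'
    and c c', [y] and [y'] join p c and p c'. *)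
Definition swap_mx (R : realType) (t b h x k z y y' : R) : 'M[R]_5 :=
  rows_mx 5 5 [:: [:: t; b; 0; b; 0];
                  [:: b; h; y; x; y'];
                  [:: 0; y; k; y'; z];
                  [:: b; x; y'; h; y];
                  [:: 0; y'; z; y; k]].

Lemma char_poly_swap_mx (R : realType) (t b h x k z y y' : R) :
  char_poly (swap_mx t b h x k z y y') =
  (('X - t%:P) * (('X - (h + x)%:P) * ('X - (k + z)%:P) - ((y + y') ^+ 2)%:P)
     - (b ^+ 2 *+ 2)%:P * ('X - (k + z)%:P))
  * (('X - (h - x)%:P) * ('X - (k - z)%:P) - ((y - y') ^+ 2)%:P).
Proof.
(* The first three columns span the invariant space of symmetric vectors, so [N] is block
   triangular. Completing with e_p' and e_c' keeps [T] unitriangular and avoids halves. *)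
pose T : 'M[R]_5 := rows_mx 5 5 [:: [:: 1; 0; 0; 0; 0];
  [:: 0; 1; 0; 0; 0]; [:: 0; 0; 1; 0; 0]; [:: 0; 1; 0; 1; 0];
  [:: 0; 0; 1; 0; 1]].
pose N : 'M[R]_(3 + 2) := rows_mx 5 5 [:: [:: t; b *+ 2; 0; b; 0];
  [:: b; h + x; y + y'; x; y']; [:: 0; y + y'; k + z; y'; z];
  [:: 0; 0; 0; h - x; y - y']; [:: 0; 0; 0; y - y'; k - z]].
have -> : char_poly (swap_mx t b h x k z y y') = char_poly N.
  apply: (@char_poly_sim _ _ _ _ T).
    apply/matrixP => i j; rewrite !mxE !big_ord_recl !big_ord0 !mxE /=.
    case: i => [[|[|[|[|[|?]]]]] ?] //;
      by case: j => [[|[|[|[|[|?]]]]] ?] //=; ring.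
  rewrite det_trig; last first.
    apply/is_trig_mxP => [[[|[|[|[|[|?]]]]] ?]] [[|[|[|[|[|?]]]]] ?] //;
      by rewrite mxE.
  by rewrite !big_ord_recl big_ord0 !mxE /= !mulr1.
rewrite char_poly_ublock; last first.
  apply/matrixP => i j; rewrite !mxE.
  by case: i => [[|[|?]] ?] //; case: j => [[|[|[|?]]] ?].
rewrite /char_poly !(expand_det_row _ ord0) !big_ord_recl !big_ord0 /cofactor.
rewrite !(expand_det_row _ ord0) !big_ord_recl !big_ord0 /cofactor.
rewrite ?det_mx00 ?det_mx11 !mxE /= /bump /=.
rewrite !(polyCD, polyCN, polyCM, rmorphMn, polyCB, rmorphXn) /= ?polyC0.
ring.
Qed.

Lemma sym_nonneg_realizable_perm (R : realType) (n : nat)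
    (sigma tau : n.-tuple R) :
  perm_eq sigma tau -> sym_nonneg_realizable sigma -> sym_nonneg_realizable tau.
Proof.
move=> st [A [Asym A_ge0 As]]; exists A; split=> //.
by rewrite /has_spectrum As (perm_big _ st).
Qed.

(* (t, p, q) and (p', q') are the diagonals of the symmetric and antisymmetric
   blocks; g, w and w' are their squared off-diagonal entries. *)
Lemma swap_realizable (R : realType) (t g p q p' q' w w' a1 a2 a3 a4 a5 : R) :
  0 <= t -> 0 <= g -> `|p'| <= p -> `|q'| <= q -> 0 <= w' <= w ->
  t + p + q = a1 + a2 + a3 ->
  t * (p + q) + p * q - w - g = a1 * a2 + a1 * a3 + a2 * a3 ->
  t * (p * q - w) - g * q = a1 * a2 * a3 ->
  p' + q' = a4 + a5 -> p' * q' - w' = a4 * a5 ->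
  sym_nonneg_realizable [tuple a1; a2; a3; a4; a5].
Proof.
move=> t0 g0 pp' qq' /andP[w'0 w'w] e1 e2 e3 f1 f2.
have half_sum (u v : R) : (u + v) / 2 + (u - v) / 2 = u by field.
have half_diff (u v : R) : (u + v) / 2 - (u - v) / 2 = v by field.
have half_ge0 (u v : R) : `|v| <= u -> 0 <= (u + v) / 2 /\ 0 <= (u - v) / 2.
  by rewrite ler_norml => /andP[? ?]; split; lra.
have [h0 x0] := half_ge0 _ _ pp'; have [k0 z0] := half_ge0 _ _ qq'.
have [y0 y'0] : 0 <= (Num.sqrt w + Num.sqrt w') / 2 /\
    0 <= (Num.sqrt w - Num.sqrt w') / 2.
  by apply: half_ge0; rewrite ger0_norm ?sqrtr_ge0 ?ler_wsqrtr.
have g2 : Num.sqrt (g / 2) ^+ 2 *+ 2 = g.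
  by rewrite sqr_sqrtr ?divr_ge0 ?ler0n// -mulr_natr divfK ?pnatr_eq0.
(* Entries are half sums and half differences of the two blocks. In an orthonormal basis w is joined
   to p + p' with weight sqrt 2 times [b], hence [g / 2]. *)
exists (swap_mx t (Num.sqrt (g / 2)) ((p + p') / 2) ((p - p') / 2)
  ((q + q') / 2) ((q - q') / 2) ((Num.sqrt w + Num.sqrt w') / 2)
  ((Num.sqrt w - Num.sqrt w') / 2)); split.
- apply/matrixP => i j; rewrite !mxE.
  by case: i => [[|[|[|[|[|?]]]]] ?] //; case: j => [[|[|[|[|[|?]]]]] ?].
- move=> i j; rewrite mxE.
  have := sqrtr_ge0 (g / 2).
  by case: i => [[|[|[|[|[|?]]]]] ?] //; case: j => [[|[|[|[|[|?]]]]] ?] /=.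
rewrite /has_spectrum char_poly_swap_mx !half_sum !half_diff g2.
rewrite !sqr_sqrtr ?(le_trans w'0)// !big_cons big_nil mulr1 !mulrA.
have cubic (u v s : R) : ('X - u%:P) * ('X - v%:P) * ('X - s%:P) =
    'X ^+ 3 - (u + v + s)%:P * 'X ^+ 2 + (u * v + u * s + v * s)%:P * 'X
    - (u * v * s)%:P.
  by rewrite !(polyCD, polyCM); ring.
rewrite cubic -mulrA -e1 -e2 -e3; congr (_ * _).
  by rewrite !(polyCD, polyCM, polyCN) /=; ring.
transitivity ('X ^+ 2 - (p' + q')%:P * 'X + (p' * q' - w')%:P).
  by rewrite !(polyCD, polyCM, polyCN) /=; ring.
by rewrite f1 f2 !(polyCD, polyCM); ring.
Qed.

(** * Three realizing matrices *)

Lemma fork_realizable (R : realType) (l1 l2 l3 l4 l5 : R) :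
  0 <= l3 -> l4 <= 0 -> l5 <= 0 -> 0 <= l1 + l4 -> l2 + l4 <= 0 ->
  0 <= l1 + l2 + l4 + l5 ->
  sym_nonneg_realizable [tuple l1; l2; l3; l4; l5].
Proof.
move=> l3_ge0 l4_le0 l5_le0 l14 l24 l1245.
(* Here w is isolated with loop [l3], and the antisymmetric block is diag(l4, l5). Taking p = -l4
   leaves no loop at p; q and w then give the rest of the symmetric block the eigenvalues [l1],
   [l2]. *)
apply: (@swap_realizable _ l3 0 (- l4) (l1 + l2 + l4) l4 l5
  ((l1 + l4) * (- l2 - l4)) 0) => //; try ring.
- by rewrite ler0_norm.
- by rewrite ler0_norm//; lra.
- by rewrite lexx mulr_ge0//; lra.
Qed.

Lemma path_realizable (R : realType) (l1 l2 l3 l4 l5 : R) :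
  0 <= l1 -> 0 <= l2 -> l3 <= 0 -> l4 <= 0 -> l5 < 0 ->
  l2 + l3 + l4 <= 0 -> 0 <= l1 + l3 + l4 ->
  0 <= l1 + l2 + l3 + l4 + l5 ->
  sym_nonneg_realizable [tuple l1; l2; l3; l4; l5].
Proof.
move=> l1_ge0 l2_ge0 l3_le0 l4_le0 l5_lt0 l234 l134 sum_ge0.
set q := l1 + l2 + l3 + l4; have q_gt0 : 0 < q by rewrite /q; lra.
have qn0 : q != 0 by rewrite gt_eqF.
have qE : l1 + l2 + l3 - q = - l4 by rewrite /q; ring.
(* With t = 0 the symmetric block has determinant -g q, which fixes [g]; its characteristic
   polynomial at [q] equals -q w, which fixes w below. *)
pose g := l1 * l2 * - l3 / q.
have gq : g * q = - (l1 * l2 * l3) by rewrite /g divfK//; ring.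
apply: (@swap_realizable _ 0 g (- l4) q l4 l5
  ((l1 - q) * (q - l2) * (q - l3) / q) 0) => //.
- by rewrite /g !(mulr_ge0, invr_ge0) ?(ltW q_gt0)//; lra.
- by rewrite ler0_norm.
- by rewrite ler0_norm ?(ltW l5_lt0)// /q; lra.
- by rewrite lexx !(mulr_ge0, invr_ge0) ?(ltW q_gt0)// /q; lra.
- by rewrite /q; ring.
- by rewrite -qE /g; field.
- by rewrite !mul0r gq; ring.
- by ring.
Qed.

Lemma cycle_realizable (R : realType) (l1 l2 l3 l4 l5 : R) :
  0 <= l2 -> 0 <= l3 -> 0 < l2 + l3 -> l5 < 0 -> l3 + l5 <= 0 -> 0 <= l1 + l5 ->
  l2 + l4 < 0 -> l1 + l2 + l4 + l5 <= 0 ->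
  0 <= l1 + l2 + l3 + l4 + l5 -> 0 <= r5 l1 l2 l3 l4 l5 ->
  sym_nonneg_realizable [tuple l1; l2; l3; l4; l5].
Proof.
set t := l1 + l2 + l3 + l4 + l5; set r := r5 _ _ _ _ _.
move=> l2_ge0 l3_ge0 l23_gt0 l5_lt0 l35 l15 l24 l1245 t_ge0 r_ge0.
(* With no loops at p and c and y' = 0, the second symmetric function forces g = [S] and the
   determinant forces q = [Z / S]. *)
pose S := - t * (l2 + l5) + l2 * l5 - (l1 * l3 + l1 * l4 + l3 * l4).
pose Z := l2 * l5 * t - l1 * l3 * l4.
have m_gt0 : 0 < l2 - l5 by lra.
have S_gt0 : 0 < S.
  rewrite -(pmulr_rgt0 _ m_gt0).
  (* Let P be the monic cubic with roots l1, l3, l4. Then P(X) = (X - t)(X + l2)(X + l5) - S X + Z,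
     so its values at -l2 and -l5 determine both [S] and [Z]. *)
  have -> : (l2 - l5) * S = (l1 + l5) * (- l3 - l5) * (- l4 - l5)
      + (l1 + l2) * (l2 + l3) * (- l2 - l4) by rewrite /S /t; ring.
  by rewrite ltr_wpDl ?mulr_ge0 ?mulr_gt0//; lra.
have Z_ge0 : 0 <= Z.
  rewrite -(pmulr_rge0 _ m_gt0).
  have -> : (l2 - l5) * Z = - l5 * (l1 + l2) * (l2 + l3) * (- l2 - l4)
      - l2 * (l1 + l5) * (- l3 - l5) * (- l4 - l5) by rewrite /Z /t; ring.
  have -> : - l5 * (l1 + l2) * (l2 + l3) * (- l2 - l4)
      - l2 * (l1 + l5) * (- l3 - l5) * (- l4 - l5) =
      (l1 + l2) * (- l2 - l4) * l3 * (l2 - l5)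
      + l2 * (- l3 - l5) * (l2 - l5) * (- (l1 + l2 + l4 + l5)) by ring.
  by rewrite addr_ge0 ?mulr_ge0//; lra.
have Sn0 : S != 0 by rewrite gt_eqF.
(* The antisymmetric trace forces p + q = -(l2 + l5), so p = [r / S]: this is where r(sigma) comes
   from. *)
have rZ : r + Z = - (l2 + l5) * S by rewrite /r /r5 /Z /S /t; ring.
have xz : r / S + Z / S = - (l2 + l5) by rewrite -mulrDl rZ mulfK.
have x_ge0 : 0 <= r / S by rewrite divr_ge0 // ltW.
have z_ge0 : 0 <= Z / S by rewrite divr_ge0 // ltW.
have w_ge0 : 0 <= r / S * (Z / S) - l2 * l5.
  by rewrite -mulrN; apply: addr_ge0; apply: mulr_ge0 => //; lra.
suff : sym_nonneg_realizable [tuple l1; l3; l4; l2; l5].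
  apply: sym_nonneg_realizable_perm => /=; rewrite perm_cons.
  by rewrite (perm_catCA [:: l3; l4] [:: l2] [:: l5]).
apply: (@swap_realizable _ t S (r / S) (Z / S) (- (r / S)) (- (Z / S))
  (r / S * (Z / S) - l2 * l5) (r / S * (Z / S) - l2 * l5)).
- by [].
- exact: ltW.
- by rewrite normrN ger0_norm.
- by rewrite normrN ger0_norm.
- by rewrite lexx w_ge0.
- by rewrite -addrA xz /t; ring.
- by rewrite xz /S; ring.
- by rewrite [X in _ - X]mulrC divfK// /Z; ring.
- by rewrite -opprD xz opprK.
- by ring.
Qed.

Theorem theorem8 (R : realType) (sigma : 5.-tuple R)
    (h_trace : 0 <= esymf 1 sigma)
    (h_order : [/\ sigma`_0 >= sigma`_1, sigma`_1 >= sigma`_2,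
                   sigma`_2 >= sigma`_3, sigma`_3 >= sigma`_4
                 & sigma`_4 > - sigma`_0])
    (h_third : sigma`_2 > esymf 1 sigma)
    (h_r : 0 <= rfun sigma)
    (s : R) (hs : 0 < s) (i : 'I_5) (hi : i != ord0) :
  sym_nonneg_realizable (shift_list sigma i s).
Proof.
move: h_trace h_order h_third h_r; rewrite rfun_r5 esymf1_5.
set l1 := sigma`_0; set l2 := sigma`_1; set l3 := sigma`_2.
set l4 := sigma`_3; set l5 := sigma`_4.
move=> t_ge0 [l12 l23 l34 l45 l15] l3_gt r_ge0.
have shiftE (tau : 5.-tuple R) :
    (forall j : 'I_5, tau`_j = if j == ord0 then sigma`_j + s
       else if j == i then sigma`_j - s else sigma`_j) ->
    sym_nonneg_realizable tau -> sym_nonneg_realizable (shift_list sigma i s).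
  move=> tauE; congr sym_nonneg_realizable; apply: eq_from_tnth => j.
  by rewrite tnth_mktuple !(tnth_nth 0) tauE.
(* Otherwise r would be negative. This bound signs the increments of r when lambda_2 or lambda_4 is
   lowered. *)
have l235 : l2 + l3 + l5 <= 0.
  rewrite leNgt; apply/negP => l235.
  have m_gt0 : 0 < l2 - l5 by lra.
  move: r_ge0; rewrite -(pmulr_rge0 _ m_gt0) leNgt -oppr_gt0 => /negP; apply.
  have -> : - ((l2 - l5) * r5 l1 l2 l3 l4 l5) =
      (l2 - l5) * ((l1 + l2) * (- l2 - l4) * (l2 + l3 + l5)
        + (- l5) * (- l3 - l5) * - (l1 + l2 + l4 + l5)) by rewrite /r5; ring.
  by rewrite mulr_gt0// ltr_wpDr ?mulr_gt0 ?mulr_ge0//; lra.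
case: i hi shiftE => [[|[|[|[|[|?]]]]] hi5] // _ shiftE.
- apply: (shiftE [tuple l1 + s; l2 - s; l3; l4; l5]).
    by case=> [[|[|[|[|[|?]]]]] ?].
  (* Once [l2 - s] is negative, it takes the nonpositive third slot of [path_realizable]. *)
  have [s_le|s_gt] := leP s l2; last first.
    apply: (@sym_nonneg_realizable_perm _ _
      [tuple l1 + s; l3; l2 - s; l4; l5]).
      by rewrite /= perm_cons (perm_catCA [:: l3] [:: l2 - s]).
    by apply: path_realizable; lra.
  apply: cycle_realizable; try lra.
  have -> : r5 (l1 + s) (l2 - s) l3 l4 l5 = r5 l1 l2 l3 l4 l5
      + s * ((l1 + l2) * (l1 - l2 - (l1 + l2 + l3 + l4 + l5) + s)).
    by rewrite /r5; ring.
  by rewrite addr_ge0 ?mulr_ge0//; lra.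
- apply: (shiftE [tuple l1 + s; l2; l3 - s; l4; l5]).
    by case=> [[|[|[|[|[|?]]]]] ?].
  have [s_gt|s_le] := ltP l3 s; first by apply: path_realizable; lra.
  (* The shift preserves the trace, so this comparison decides the sign of the sum of the entries
     other than [l3 - s], on which fork and cycle impose opposite conditions. *)
  have [l3s_lt|l3s_ge] := ltP (l3 - s) (l1 + l2 + l3 + l4 + l5).
    by apply: fork_realizable; lra.
  apply: cycle_realizable; try lra.
  have -> : r5 (l1 + s) l2 (l3 - s) l4 l5 = r5 l1 l2 l3 l4 l5
      + s * ((l1 - l3 + s) * - (l2 + l4 + l5)) by rewrite /r5; ring.
  by rewrite addr_ge0 ?mulr_ge0//; lra.
- apply: (shiftE [tuple l1 + s; l2; l3; l4 - s; l5]).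
    by case=> [[|[|[|[|[|?]]]]] ?].
  apply: cycle_realizable; try lra.
  have -> : r5 (l1 + s) l2 l3 (l4 - s) l5 = r5 l1 l2 l3 l4 l5
      + s * ((l1 - l4 + s) * - (l2 + l3 + l5)) by rewrite /r5; ring.
  by rewrite addr_ge0 ?mulr_ge0//; lra.
apply: (shiftE [tuple l1 + s; l2; l3; l4; l5 - s]).
  by case=> [[|[|[|[|[|?]]]]] ?].
apply: cycle_realizable; try lra.
have -> : r5 (l1 + s) l2 l3 l4 (l5 - s) = r5 l1 l2 l3 l4 l5
    + s * ((l1 + l5) * (l1 - l5 + s - (l1 + l2 + l3 + l4 + l5))).
  by rewrite /r5; ring.
by rewrite addr_ge0 ?mulr_ge0//; lra.
Qed.
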